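(* For any planar graph $G$, if $\mathcal{B}=\{N[v]\mid v\in V(G)\}$, then NCTD$^+(\mathcal{B})\le 7$.
   Context: $N[v]$ is the closed neighborhood of $v$. A positive teaching map for $\mathcal{B}$ assigns to each $B\in\mathcal{B}$ a set $T(B)\subseteq B$. A vertex $w$ distinguishes $B,B'$ if $w$ lies in exactly one of them. $T$ is non-clashing if for all distinct $B,B'\in\mathcal{B}$ some $w\in T(B)\cup T(B')$ distinguishes them; its size is $\max_{B\in\mathcal{B}}|T(B)|$. NCTD$^+(\mathcal{B})$ is the minimum size of a positive non-clashing teaching map for $\mathcal{B}$. *)

(* Defs.v *)
From HB Require Import structures.
From mathcomp Require Import all_boot all_order all_algebra.
From mathcomp Require Import all_classical all_reals all_analysis.
From mathcomp Require Import Rstruct Rstruct_topology.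
From Stdlib Require Import Reals.

Set Implicit Arguments.
Unset Strict Implicit.
Unset Printing Implicit Defensive.

Import Order.TTheory GRing.Theory Num.Theory.

Definition simple_graph (V : finType) (e : rel V) : Prop :=
  symmetric e /\ irreflexive e.

Local Open Scope ring_scope.
Local Open Scope classical_set_scope.

Definition unit_interval : set R := [set t : R | 0 <= t <= 1].
Definition open_unit_interval : set R := [set t : R | 0 < t < 1].

Definition planar_embedding (V : finType) (e : rel V)
    (pos : V -> R * R) (arc : V -> V -> R -> R * R) : Prop :=
  injective pos /\
  (forall x y, e x y ->
     [/\ {within unit_interval, continuous (arc x y)},
         {in unit_interval &, injective (arc x y)},
         arc x y 0 = pos x, arc x y 1 = pos y
       & forall t, arc y x t = arc x y (1 - t)]) /\
  (forall x y w t, e x y -> open_unit_interval t -> arc x y t <> pos w) /\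
  (forall x y u v t s, e x y -> e u v ->
     [set x; y]%SET != [set u; v]%SET ->
     open_unit_interval t -> open_unit_interval s ->
     arc x y t <> arc u v s).

Definition planar (V : finType) (e : rel V) : Prop :=
  simple_graph e /\ exists pos arc, @planar_embedding V e pos arc.

Local Close Scope classical_set_scope.

Definition closed_nbhd (V : finType) (e : rel V) (v : V) : {set V} :=
  [set u | (u == v) || e v u].

Definition closed_nbhd_family (V : finType) (e : rel V) : {set {set V}} :=
  [set closed_nbhd e v | v in V].

Definition distinguishes (V : finType) (w : V) (B B' : {set V}) : bool :=
  (w \in B) != (w \in B').

Definition positive_nc_teaching_map (V : finType) (F : {set {set V}})
    (T : {set V} -> {set V}) : Prop :=
  (forall B, B \in F -> T B \subset B) /\
  (forall B B', B \in F -> B' \in F -> B != B' ->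
     exists2 w, w \in T B :|: T B' & distinguishes w B B').

Definition tm_size (V : finType) (F : {set {set V}}) (T : {set V} -> {set V})
  : nat := (\max_(B in F) #|T B|)%N.

(* NCTD^+(F) <= k  iff  some positive non-clashing teaching map has size <= k
   (NCTD^+ is a minimum over such maps). *)
Definition NCTD_plus_le (V : finType) (F : {set {set V}}) (k : nat) : Prop :=
  exists T, positive_nc_teaching_map F T /\ leq (tm_size F T) k.

(* Main.v *)
(** A positive non-clashing map for closed neighborhoods of size at most 6 exists
    in every graph without a [K33] subgraph. If [v] has at least 6 neighbors, two
    of them, [b] and [c], are non-adjacent; let [a] be a third one. A vertex [u]
    with [v, a, b, c] in [N[u]] is either [a] or a common neighbor of [a], [b], [c]
    other than [v], and there is at most one of the latter; so two more elements
    of [N[v]] separate [N[v]] from every [N[u]] not containing it.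

    That [K33] is not planar is shown with winding numbers modulo 2. For disjoint
    edges [p], [q] the map [(s, t) |-> q t - p s] avoids the origin on the unit
    square, so it has winding number zero along the boundary of the square. This
    relates the winding of each edge about the end points of the other one to the
    directions between the four end points; adding these relations over the 18
    pairs of disjoint edges of [K33] yields [1 = 0] modulo 2. The arcs are replaced
    by fine samples, which uniform continuity and compactness make legitimate. *)

Require Import Defs.
From mathcomp Require Import all_boot all_order all_algebra.
From mathcomp Require Import all_classical all_reals all_analysis.
From mathcomp Require Import Rstruct Rstruct_topology.
(* Again, so that their names shadow the homonyms of classical_sets. *)
From mathcomp Require Import fintype finset.
From mathcomp Require Import lra zify.

Set Implicit Arguments.
Unset Strict Implicit.
Unset Printing Implicit Defensive.

Import Order.TTheory GRing.Theory Num.Theory.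
Import numFieldNormedType.Exports.

Local Open Scope classical_set_scope.
Local Open Scope ring_scope.

(** * Winding numbers modulo 2 of sampled curves *)

Lemma addb_rearrange a b c d u u' v v' :
  a (+) (d (+) (v (+) v')) = (c (+) (u (+) u')) (+) b ->
  a (+) b (+) (c (+) d) = (u (+) u') (+) (v (+) v').
Proof. by move: a b c d u u' v v' => [] [] [] [] [] [] [] []. Qed.

Section Winding.
Variable K : realType.
Implicit Types (z w t : K * K) (eta : K).

(* Half-open, so that exactly one of [z] and [- z] is upper when [z != 0]. *)
Definition upper z : bool := (0 < z.2) || ((z.2 == 0) && (0 < z.1)).

(* For [z], [w] close together and away from the origin, the parity of the number
   of crossings of the negative horizontal axis on the way from [z] to [w]. *)
Definition cut z w : bool := (upper z (+) upper w) && (z.1 < 0).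

Definition box_close eta z w : Prop :=
  (`|z.1 - w.1| < eta) /\ (`|z.2 - w.2| < eta).

Definition box_far eta z : Prop := (eta <= `|z.1|) \/ (eta <= `|z.2|).

Lemma upper_opp z : z != 0 -> upper (- z) = ~~ upper z.
Proof.
case: z => x y; rewrite /upper /= xpair_eqE !oppr_gt0 oppr_eq0 /=.
by case: (ltrgtP y 0) => //= _; rewrite andbT; case: ltrgtP.
Qed.

(** A second coordinate of size at least [eta] keeps its sign under a move shorter than [eta]. So if
    [upper] changes, both first coordinates are large, hence of equal sign. *)
Lemma upper_neq_fst eta z w : box_close eta z w -> box_far eta z -> box_far eta w ->
  upper z != upper w -> (z.1 != 0) && ((z.1 < 0) == (w.1 < 0)).
Proof.
case: z w => [x y] [x' y'] [/= hx hy] fz fw.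
have y0 : eta <= `|y| -> upper (x, y) = upper (x', y').
  move=> e; rewrite /upper /=.
  case: (ltrgtP y 0) => hy0; case: (ltrgtP y' 0) => hy'0 //=; exfalso;
  move: e hy; rewrite ?ler_normr ?ltr_norml => e /andP[h1 h2]; lra.
have y'0 : eta <= `|y'| -> upper (x, y) = upper (x', y').
  move=> e; rewrite /upper /=.
  case: (ltrgtP y 0) => hy0; case: (ltrgtP y' 0) => hy'0 //=; exfalso;
  move: e hy; rewrite ?ler_normr ?ltr_norml => e /andP[h1 h2]; lra.
move=> /eqP U; case: fz => /= [fz|/y0 //]; case: fw => /= [fw|/y'0 //].
apply/andP; split.
  apply/eqP => x0; move: hx fz.
  by rewrite x0 normr0 => /(le_lt_trans (normr_ge0 _)); lra.
apply/eqP; case: (ltrP x 0) => hx0; case: (ltrP x' 0) => hx'0 //; exfalso;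
move: fz fw hx; rewrite ?ler_normr ?ltr_norml => e e' /andP[h1 h2]; lra.
Qed.

(** [upper] changes along none or two of the three pairs, and two changes happen on the same side of
    the vertical axis. *)
Lemma cut_cocycle eta z w t :
  box_close eta z w -> box_close eta w t -> box_close eta z t ->
  box_far eta z -> box_far eta w -> box_far eta t ->
  cut z w (+) cut w t = cut z t.
Proof.
move=> zw wt zt fz fw ft; rewrite /cut.
have := upper_neq_fst zw fz fw; have := upper_neq_fst wt fw ft.
have := upper_neq_fst zt fz ft.
case: (upper z) (upper w) (upper t) => [] [] [] //= h1 h2 h3;
  do ?[move: (h1 isT) => {h1}/andP[_ /eqP h1]];
  do ?[move: (h2 isT) => {h2}/andP[_ /eqP h2]];
  do ?[move: (h3 isT) => {h3}/andP[_ /eqP h3]]; rewrite ?h1 ?h2 ?h3 ?addbb //.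
all: by rewrite -?h1 -?h2 -?h3 ?addbb ?addbF.
Qed.

(** A change of [upper] crosses either the negative or the positive horizontal axis; negation
    exchanges the two. *)
Lemma cut_opp eta z w : box_close eta z w -> box_far eta z -> box_far eta w ->
  0 < eta ->
  cut (- z) (- w) = cut z w (+) (upper z (+) upper w).
Proof.
move=> zw fz fw eta0.
have nz (v : K * K) : box_far eta v -> v != 0.
  move=> fv; apply/eqP => v0; move: fv; rewrite v0 /box_far /= normr0; lra.
rewrite /cut !upper_opp ?nz // oppr_lt0.
have := upper_neq_fst zw fz fw.
case: (upper z) (upper w) => [] [] //= /(_ isT) /andP[]; case: ltrgtP => //.
Qed.

(** Counts crossings of the leftward ray from [z]. For an open curve the choice of ray matters,
    hence the [upper] terms in [winding_square]. *)
Definition winding (N : nat) (p : nat -> K * K) z : bool :=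
  \big[addb/false]_(0 <= k < N) cut (p k - z) (p k.+1 - z).

(** Discrete Green's theorem modulo 2: interior edges of the grid cancel. *)
Lemma grid_sum (H V : nat -> nat -> bool) (M N : nat) :
  (forall k l, (k < M)%N -> (l < N)%N ->
    H k l (+) V k l.+1 = V k l (+) H k.+1 l) ->
  (\big[addb/false]_(0 <= l < N) H 0 l) (+) (\big[addb/false]_(0 <= k < M) V k N)
  = (\big[addb/false]_(0 <= k < M) V k 0) (+) (\big[addb/false]_(0 <= l < N) H M l).
Proof.
elim: M => [|M IH] h; first by rewrite !big_nil addbF addFb.
have row : (\big[addb/false]_(0 <= l < N) H M l) (+) V M N
  = V M 0 (+) (\big[addb/false]_(0 <= l < N) H M.+1 l).
  have {h IH} : forall l, (l < N)%N -> H M l (+) V M l.+1 = V M l (+) H M.+1 l.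
    by move=> l; apply: h.
  elim: N => [|N IN] h; first by rewrite !big_nil addbF.
  rewrite !big_nat_recr //= -addbA h // addbA IN ?addbA // => l lN.
  by apply: h; rewrite ltnS ltnW.
rewrite !big_nat_recr //= addbA IH; first by rewrite -addbA row addbA.
by move=> k l kM lN; apply: h => //; rewrite ltnS ltnW.
Qed.

(* The loop traced by [q l - p k] around the boundary of the parameter square
   bounds, so it has winding number zero; two of the sides are read with the
   opposite sign. *)
Lemma winding_square (N : nat) (p q : nat -> K * K) eta : 0 < eta ->
  (forall k, (k < N)%N -> box_close (eta / 2) (p k) (p k.+1)) ->
  (forall k, (k < N)%N -> box_close (eta / 2) (q k) (q k.+1)) ->
  (forall k l, (k <= N)%N -> (l <= N)%N -> box_far eta (q l - p k)) ->
  winding N q (p 0) (+) winding N q (p N) (+)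
  (winding N p (q 0) (+) winding N p (q N)) =
  (upper (p 0 - q 0) (+) upper (p N - q 0)) (+)
  (upper (p 0 - q N) (+) upper (p N - q N)).
Proof.
move=> eta0 cp cq f.
pose H k l := cut (q l - p k) (q l.+1 - p k).
pose V k l := cut (q l - p k) (q l - p k.+1).
have sq k l : (k < N)%N -> (l < N)%N ->
    H k l (+) V k l.+1 = V k l (+) H k.+1 l.
  move=> kN lN; have [c1 c2] := cp _ kN; have [d1 d2] := cq _ lN.
  (* Both ways around a cell give [cut] along its diagonal; two steps below [eta / 2] keep the
     diagonal below [eta]. *)
  rewrite /H /V !(@cut_cocycle eta) //; try (by apply: f; rewrite // ltnW);
  split; rewrite /=; move: c1 c2 d1 d2; rewrite !ltr_norml;
  do 4 (move=> /andP[? ?]); lra.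
(* The corrections from [cut_opp] telescope to the two end points. *)
have side l : (l <= N)%N -> \big[addb/false]_(0 <= k < N) V k l =
    winding N p (q l) (+) (upper (p 0 - q l) (+) upper (p N - q l)).
  move=> lN; rewrite /winding.
  have {sq} : forall M, (M <= N)%N -> \big[addb/false]_(0 <= k < M) V k l =
    (\big[addb/false]_(0 <= k < M) cut (p k - q l) (p k.+1 - q l)) (+)
      (upper (p 0 - q l) (+) upper (p M - q l)).
    elim=> [|M IH] MN; first by rewrite !big_nil addbb.
    rewrite !big_nat_recr //= IH ?(ltnW MN) // /V.
    rewrite -[q l - p M]opprB -[q l - p M.+1]opprB.
    rewrite (@cut_opp eta) //.
    - by case: (\big[_/_]_(_ <= _ < _) _) (cut _ _) (upper (p 0 - q l))
         (upper (p M - q l)) (upper (p M.+1 - q l)) => [] [] [] [] [].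
    - have [c1 c2] := cp _ MN; split; rewrite /=; move: c1 c2; rewrite !ltr_norml;
      do 2 (move=> /andP[? ?]); lra.
    - have := f M l (ltnW MN) lN.
      by rewrite /box_far /= distrC [X in _ \/ _ <= X]distrC.
    - have := f M.+1 l MN lN.
      by rewrite /box_far /= distrC [X in _ \/ _ <= X]distrC.
  by apply.
have : winding N q (p 0) (+)
    (winding N p (q N) (+) (upper (p 0 - q N) (+) upper (p N - q N))) =
    (winding N p (q 0) (+) (upper (p 0 - q 0) (+) upper (p N - q 0))) (+)
    winding N q (p N).
  by rewrite -!side //; exact: grid_sum sq.
exact: addb_rearrange.
Qed.

End Winding.

(** * Non-planarity of K33 *)

(* Summed over the pairs of disjoint edges, every term occurs an even number of
   times, except that [ubb j j'] and [ubb j' j] occur three times each. *)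
Lemma K33_parity (wa wb : 'I_3 -> 'I_3 -> 'I_3 -> bool)
  (uaa ubb uab uba : 'I_3 -> 'I_3 -> bool) :
  (forall j j', j != j' -> ubb j j' = ~~ ubb j' j) ->
  ~ forall i i' j j', i != i' -> j != j' ->
    wa i i' j' (+) wb j i' j' (+) (wa i' i j (+) wb j' i j) =
    (uaa i i' (+) uba j i') (+) (uab i j' (+) ubb j j').
Proof.
move=> ubbN H.
pose f i i' j j' : nat := (wa i i' j' + wb j i' j' + wa i' i j + wb j' i j
  + (uaa i i' + uba j i' + uab i j' + ubb j j'))%N.
have f_even i i' j j' : i != i' -> j != j' -> ~~ odd (f i i' j j').
  move=> ii' jj'; rewrite /f !oddD !oddb; have := H _ _ _ _ ii' jj'.
  by move: (wa _ _ _) (wb _ _ _) (wa _ _ _) (wb _ _ _) (uaa _ _) (uba _ _)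
    (uab _ _) (ubb _ _) => [] [] [] [] [] [] [] [].
pose i0 : 'I_3 := @Ordinal 3 0 isT; pose i1 : 'I_3 := @Ordinal 3 1 isT.
pose i2 : 'I_3 := @Ordinal 3 2 isT.
pose pairs := [:: (i0, i1); (i0, i2); (i1, i2)].
pose swap (p : 'I_3 * 'I_3) := (p.2, p.1).
(* A pair of disjoint edges is an unordered pair of [i]s with an ordered pair of [j]s: 3 * 6 =
   18. *)
have : ~~ odd (\sum_(p <- pairs) \sum_(q <- pairs ++ map swap pairs)
    f p.1 p.2 q.1 q.2)%N.
  rewrite big_seq; elim/big_ind: _ => // [m n|p pP].
    by rewrite oddD => /negPf-> /negPf->.
  rewrite big_seq; elim/big_ind: _ => // [m n|q qP].
    by rewrite oddD => /negPf-> /negPf->.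
  apply: f_even.
    by move: p pP; apply/allP.
  by move: q qP; apply/allP.
have N (j j' : 'I_3) (jj' : j != j') : (ubb j j' + ubb j' j = 1)%N.
  by rewrite ubbN //; case: (ubb _ _).
move: (N i0 i1 isT) (N i0 i2 isT) (N i1 i2 isT).
rewrite /pairs /= !big_cons !big_nil /f /=; clear -i0 i1 i2.
repeat match goal with
| |- context [nat_of_bool ?b] => generalize (nat_of_bool b); intro
end.
lia.
Qed.

(** * Uniform continuity and separation of curves by compactness *)

Section Curves.
Variable K : realType.
Let I : set K := [set t | 0 <= t <= 1].
Implicit Types (g h : K -> K * K).

Lemma unit_interval_compact : compact I.
Proof.
rewrite (_ : I = `[0, 1]%classic); first exact: segment_compact.
by apply/seteqP; split => t /=; rewrite in_itv.
Qed.

Lemma curve_near g s (eps : K) : {within I, continuous g} -> I s -> 0 < eps ->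
  \forall t \near s, I t -> ball (g s) eps (g t).
Proof.
move=> /subspace_continuousP cg Is eps0.
by have := cg s Is _ (nbhsx_ballx (g s) eps eps0).
Qed.

(** Heine-Cantor: half of a radius that works at [s] serves all points near [s]. *)
Lemma curve_unif g (eps : K) : {within I, continuous g} -> 0 < eps ->
  \forall d \near 0^'+, forall s t, I s -> I t -> `|s - t| < d ->
    ball (g s) eps (g t).
Proof.
move=> cg eps0.
have e2 : 0 < eps / 2 by lra.
have /compact_near_coveringP/near_covering_withinP cov := unit_interval_compact.
have : \forall d \near 0^'+, I `<=` [set s | forall t, I t -> `|s - t| < d ->
    ball (g s) eps (g t)].
  apply: cov => s Is.
  have /nbhs_ballP[r /= r0 rb] := curve_near cg Is e2.
  have r2 : 0 < r / 2 by lra.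
  near=> s' d => Is' t It s't.
  have ss' : ball s (r / 2) s' by near: s'; exact: nbhsx_ballx.
  have dr : d < r / 2 by near: d; exact: nbhs_right_lt.
  apply: (@ball_splitr _ _ (g s)).
  - apply: rb => //; apply: le_ball ss'; lra.
  - apply: rb => //; apply: ball_splitl ss' _; rewrite /ball /= distrC.
    exact: lt_trans s't _.
by apply: filterS => d h s t Is It; exact: h.
Unshelve. all: by end_near. Qed.

(** The image of [h] is compact, hence closed, so each [g s] has a ball missing it; half its radius
    serves nearby parameters. *)
Lemma curves_apart g h : {within I, continuous g} -> {within I, continuous h} ->
  (forall s t, I s -> I t -> g s <> h t) ->
  \forall eps \near 0^'+, forall s t, I s -> I t -> ~ ball (g s) eps (h t).
Proof.
move=> cg ch gh.
have /compact_near_coveringP/near_covering_withinP cov := unit_interval_compact.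
have : \forall eps \near 0^'+, I `<=` [set s | forall t, I t -> ~ ball (g s) eps (h t)].
  apply: cov => s Is.
  have : closed (h @` I).
    apply: compact_closed; last exact: continuous_compact ch unit_interval_compact.
    exact: norm_hausdorff.
  move=> /closed_openC op.
  have /(open_nbhs_nbhs) : open_nbhs (g s) (~` (h @` I)).
    by split => // -[t It] e; apply: (gh s t).
  move=> /nbhs_ballP[r /= r0 rb].
  have r2 : 0 < r / 2 by lra.
  near=> s' eps => Is' t It b.
  have ss' : ball (g s) (r / 2) (g s') by exact: (near (curve_near cg Is r2) s').
  have er : eps <= r / 2 by near: eps; exact: nbhs_right_le.
  by apply: (rb (h t)); [apply: ball_split ss' _; exact: (le_ball er) b | exists t].
by apply: filterS => d H s t Is It; exact: H.
Unshelve. all: by end_near. Qed.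
End Curves.

Local Notation R := Rdefinitions.R.

Section PlanarK33.
Variables (V : finType) (e : rel V).

(** Each parameter gives a vertex or an interior point; two vertices are separated by injectivity of
    [pos], the other cases by the embedding axioms. *)
Lemma disjoint_edges_apart pos arc : planar_embedding e pos arc ->
  forall x y u v s t, e x y -> e u v ->
    x != u -> x != v -> y != u -> y != v ->
    unit_interval s -> unit_interval t -> arc x y s <> arc u v t.
Proof.
move=> [pos_inj [arcP [arc_pos arc_arc]]] x y u v s t exy euv xu xv yu yv Is It.
have ends w z r : e w z -> unit_interval r ->
    [\/ arc w z r = pos w, arc w z r = pos z | open_unit_interval r].
  move=> ewz /andP[]; have [_ _ a0 a1 _] := arcP _ _ ewz.
  rewrite le_eqVlt => /orP[/eqP<-|r0]; first by constructor 1.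
  rewrite le_eqVlt => /orP[/eqP->|r1]; first by constructor 2.
  by constructor 3; apply/andP.
have neq w z : w != z -> pos w <> pos z by move=> /eqP wz /pos_inj.
have [Es|Es|os] := ends _ _ _ exy Is; have [Et|Et|ot] := ends _ _ _ euv It.
- by rewrite Es Et; exact: neq.
- by rewrite Es Et; exact: neq.
- by rewrite Es => /esym; exact: arc_pos.
- by rewrite Es Et; exact: neq.
- by rewrite Es Et; exact: neq.
- by rewrite Es => /esym; exact: arc_pos.
- by rewrite Et; exact: arc_pos.
- by rewrite Et; exact: arc_pos.
- apply: arc_arc => //; apply/eqP => /setP/(_ x).
  by rewrite !inE eqxx (negPf xu) (negPf xv).
Qed.

Lemma planar_no_K33 (a b : 'I_3 -> V) : planar e ->
  injective a -> injective b -> ~ forall i j, e (a i) (b j).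
Proof.
move=> [[esym eirr] [pos [arc emb]]] a_inj b_inj eab.
have [pos_inj [arcP _]] := emb.
have ab i j : a i != b j by apply/eqP => E; have := eab i j; rewrite E eirr.
pose g i j := arc (a i) (b j).
have gc i j : {within unit_interval, continuous (g i j)}.
  by have [] := arcP _ _ (eab i j).
have [eps [eps0 apart]] : exists eps : R, 0 < eps /\
    forall i i' j j', i != i' -> j != j' -> forall s t,
    unit_interval s -> unit_interval t -> ~ ball (g i j s) eps (g i' j' t).
  (* Indices are bundled into one finite type, so that a single [eps] serves all pairs of edges. *)
  have : \forall eps \near 0^'+, forall x : ('I_3 * 'I_3) * ('I_3 * 'I_3),
      x.1.1 != x.1.2 -> x.2.1 != x.2.2 -> forall s t,
      unit_interval s -> unit_interval t ->
      ~ ball (g x.1.1 x.2.1 s) eps (g x.1.2 x.2.2 t).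
    apply: filter_forall => -[[i i'] [j j']] /=.
    have [->|ii'] := eqVneq i i'; first by apply: nearW.
    have [->|jj'] := eqVneq j j'; first by apply: nearW.
    apply: filterS (curves_apart (gc i j) (gc i' j') _) => [eps h _ _ //|s t Is It].
    apply: (disjoint_edges_apart emb) => //; rewrite ?(inj_eq a_inj) ?(inj_eq b_inj) //.
    by rewrite eq_sym.
  move=> near_apart; near (0 : R)^'+ => eps; exists eps; split; first by [].
  move=> i i' j j' ii' jj' s t Is It.
  by have := near near_apart eps; move=> /(_ _ ((i, i'), (j, j'))); apply.
have eps2 : 0 < eps / 2 by lra.
have [N [N0 cl]] : exists N : nat, (0 < N)%N /\
    forall i j s t, unit_interval s -> unit_interval t -> `|s - t| <= N%:R^-1 ->
      ball (g i j s) (eps / 2) (g i j t).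
  have near_close : \forall d \near 0^'+, forall x : 'I_3 * 'I_3, forall s t,
      unit_interval s -> unit_interval t -> `|s - t| < d ->
      ball (g x.1 x.2 s) (eps / 2) (g x.1 x.2 t).
    by apply: filter_forall => -[i j]; exact: curve_unif.
  near (0 : R)^'+ => d.
  have d0 : 0 < d by [].
  have [N Nd] : exists N : nat, (N.+1%:R : R)^-1 < d.
    exists (Num.trunc d^-1); rewrite -[ltRHS]invrK ltf_pV2 ?posrE ?invr_gt0 //.
    by rewrite truncnS_gt.
  exists N.+1; split => // i j s t Is It st.
  have := near near_close d; move=> /(_ _ (i, j)); apply => //.
  exact: le_lt_trans st Nd.
have NR : (0 : R) < N%:R by rewrite ltr0n.
pose p i j k := g i j (k%:R / N%:R).
have Ik k : (k <= N)%N -> unit_interval (k%:R / N%:R).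
  by move=> kN; apply/andP; rewrite divr_ge0 // ler_pdivrMr // mul1r ler_nat.
have p0 i j : p i j 0 = pos (a i).
  by rewrite /p mul0r /g; have [] := arcP _ _ (eab i j).
have pN i j : p i j N = pos (b j).
  by rewrite /p divff ?gt_eqF // /g; have [] := arcP _ _ (eab i j).
have pc i j k : (k < N)%N -> box_close (eps / 2) (p i j k) (p i j k.+1).
  move=> kN; have [] // : ball (p i j k) (eps / 2) (p i j k.+1).
  apply: cl; [by apply: Ik; exact: ltnW|exact: Ik|].
  by rewrite -mulrBl -natr1 opprD addNKr normrM normrN normr1 mul1r gtr0_norm ?invr_gt0.
have pf i i' j j' k l : i != i' -> j != j' -> (k <= N)%N -> (l <= N)%N ->
    box_far eps (p i' j' l - p i j k).
  move=> ii' jj' kN lN; rewrite /box_far.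
  have [|h1] := lerP eps `|(p i' j' l - p i j k).1|; first by left.
  have [|h2] := lerP eps `|(p i' j' l - p i j k).2|; first by right.
  exfalso; apply: (apart _ _ _ _ ii' jj' _ _ (Ik _ kN) (Ik _ lN)).
  by split; rewrite /ball /= distrC.
pose A i := pos (a i); pose B j := pos (b j).
apply: (@K33_parity (fun i i' j' => winding N (p i' j') (A i))
  (fun j i' j' => winding N (p i' j') (B j))
  (fun i i' => upper (A i - A i')) (fun j j' => upper (B j - B j'))
  (fun i j => upper (A i - B j)) (fun j i => upper (B j - A i))).
  move=> j j' jj'; rewrite -opprB upper_opp // subr_eq0.
  by rewrite (inj_eq pos_inj) (inj_eq b_inj) eq_sym.
move=> i i' j j' ii' jj'; rewrite /A /B -(p0 i j) -(p0 i' j') -(pN i j) -(pN i' j').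
apply: (winding_square eps0) => *; [exact: pc|exact: pc|exact: pf].
Unshelve. all: by end_near. Qed.
End PlanarK33.

(** * Teaching maps *)

Local Close Scope classical_set_scope.
Local Open Scope nat_scope.

(** [A] and [B] may overlap: in a simple graph a common element already gives a non-adjacent pair
    [x = y]. *)
Definition K33_free (V : finType) (e : rel V) : Prop :=
  forall A B : {set V}, 2 < #|A| -> 2 < #|B| ->
  exists x y, [/\ x \in A, y \in B & ~~ e x y].

Lemma planar_K33_free (V : finType) (e : rel V) : planar e -> K33_free e.
Proof.
move=> pe A B A3 B3; apply/not_existsP => h.
pose a (i : 'I_3) := enum_val (widen_ord A3 i).
pose b (i : 'I_3) := enum_val (widen_ord B3 i).
apply: (@planar_no_K33 V e a b pe).
- by move=> i j /enum_val_inj/(congr1 val) /= /val_inj.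
- by move=> i j /enum_val_inj/(congr1 val) /= /val_inj.
move=> i j; apply: contraPT (h (a i)) => nab; apply; exists (b j).
by rewrite !enum_valP.
Qed.

Lemma K33_free_teaching_set (V : finType) (e : rel V) (v : V) :
  simple_graph e -> K33_free e ->
  exists X : {set V}, [/\ X \subset closed_nbhd e v, #|X| <= 6 &
    forall u, closed_nbhd e v \subset closed_nbhd e u = false ->
              X \subset closed_nbhd e u = false].
Proof.
move=> [esym eirr] free.
have [small|] := leqP #|closed_nbhd e v| 6; first by exists (closed_nbhd e v).
pose Nv := [set u | e v u].
have -> : closed_nbhd e v = v |: Nv by apply/setP => x; rewrite !inE.
rewrite cardsU1 inE eirr add1n ltnS => Nv6.
have minus3 (x y z : V) : 2 < #|Nv :\: [set x; y; z]|.
  have := cardsID [set x; y; z] Nv; have := subset_leq_card (subsetIr Nv [set x; y; z]).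
  have : #|[set x; y; z]| <= 3.
    by rewrite -setUA !cardsU1 cards1; do 2 case: (_ \notin _).
  lia.
(* Three neighbors and the at least three remaining ones cannot be completely joined. *)
have [b [c [bN cN bc nbc]]] : exists b c, [/\ b \in Nv, c \in Nv, b != c & ~~ e b c].
  have /card_gt2P[x [y [z [[xN yN zN] [xy yz zx]]]]] : 2 < #|Nv|.
    exact: leq_trans Nv6.
  have S3 : 2 < #|[set x; y; z]|.
    by apply/card_gt2P; exists x, y, z; rewrite !inE !eqxx !orbT.
  have [b [c [bS /setDP[cN cS] nbc]]] := free _ _ S3 (minus3 x y z).
  exists b, c; split => //; last by apply: contraNneq cS => <-.
  by move: bS => /setUP[/set2P[]|/set1P]->.
have [a /setDP[aN]] : exists a, a \in Nv :\: [set b; b; c].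
  by apply/set0Pn; rewrite -card_gt0; apply: leq_trans (minus3 _ _ _).
rewrite !inE orbb negb_or => /andP[ab ac].
rewrite !inE in aN bN cN.
pose X0 := [set v; a; b; c].
pose bad := [set u | (X0 \subset closed_nbhd e u)
  && ~~ (v |: Nv \subset closed_nbhd e u)].
have X0P u : u \in bad -> [/\ u != v, (u == a) || e u a, e u b & e u c].
  rewrite inE => /andP[/subsetP X0u nu].
  have Xu x : x \in X0 -> (x == u) || e u x by move/X0u; rewrite inE.
  have uv : u != v by apply: contraNneq nu => ->; apply/subsetP => x; rewrite !inE.
  have := Xu b; have := Xu c; have := Xu a.
  rewrite !inE !eqxx !orbT => /(_ isT) ua /(_ isT) uc /(_ isT) ub.
  split=> //; first by rewrite eq_sym.
  (* [u] is not [b], since [c] would then be equal or adjacent to [b]. *)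
  - by move: ub => /predU1P[bu|//]; move: uc; rewrite -bu eq_sym (negPf bc) (negPf nbc).
  - by move: uc => /predU1P[cu|//]; move: ub; rewrite -cu (negPf bc) esym (negPf nbc).
have bad2 : #|bad| <= 2.
  rewrite leqNgt; apply/negP => bad3.
  have S3 : 2 < #|[set a; b; c]|.
    apply/card_gt2P; exists a, b, c.
    by rewrite !inE !eqxx !orbT ab bc [c == a]eq_sym ac.
  (* Three bad vertices would leave two besides [a], which with [v] form a side opposite to [a],
     [b], [c]. *)
  have L3 : 2 < #|v |: (bad :\ a)|.
    have vbad : v \notin bad by apply/negP => /X0P[]; rewrite eqxx.
    rewrite cardsU1 in_setD1 (negPf vbad) andbF; have := cardsD1 a bad.
    by case: (a \in bad) => /=; lia.
  have [u [w [uL wS]]] := free _ _ L3 S3; apply/negP; rewrite negbK.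
  have [uab ubb ucc] : [/\ e u a, e u b & e u c].
    move: uL => /setU1P[->//|/setD1P[ua /X0P[_]]].
    by rewrite (negPf ua).
  by move: wS; rewrite !inE -orbA => /or3P[] /eqP->.
have wit u : exists w, u \in bad -> w \in (v |: Nv) :\: closed_nbhd e u.
  have [|] := boolP (u \in bad); last by exists u.
  rewrite inE => /andP[_ /subsetPn[w wN wu]]; exists w => _.
  by rewrite in_setD wu.
have [f fP] := fin_all_exists wit.
exists (X0 :|: f @: bad); split.
- apply/subsetP => x; rewrite in_setU => /orP[|/imsetP[u ub ->]].
    by rewrite !inE -!orbA => /or4P[] /eqP->; rewrite ?eqxx ?aN ?bN ?cN ?orbT.
  by have /setDP[] := fP _ ub.
- apply: leq_trans (leq_card_setU _ _).1 _.
  have : #|X0| <= 4 by rewrite /X0 -!setUA !cardsU1 cards1; do 3 case: (_ \notin _).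
  by have := leq_imset_card f bad; lia.
move=> u /negbT nu; apply/negbTE/negP; rewrite subUset => /andP[X0u fu].
have ub : u \in bad by rewrite inE X0u.
have /setDP[_ /negP] := fP _ ub; apply.
by move/subsetP: fu; apply; exact: imset_f.
Qed.

Theorem theorem6 (V : finType) (e : rel V) :
  planar e -> NCTD_plus_le (closed_nbhd_family e) 7.
Proof.
move=> pe.
(* Vertices may share a closed neighborhood, so the choice is made per set. *)
have teach (B : {set V}) : exists X : {set V}, B \in closed_nbhd_family e ->
    [/\ X \subset B, #|X| <= 6 & forall B', B' \in closed_nbhd_family e ->
      ~~ (B \subset B') -> ~~ (X \subset B')].
  have [/imsetP[v _ ->]|_] := boolP (B \in closed_nbhd_family e); last by exists set0.
  have [X [XB X6 XP]] := K33_free_teaching_set v (proj1 pe) (planar_K33_free pe).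
  by exists X => _; split=> // _ /imsetP[u _ ->] /negPf/XP->.
have [T TP] := fin_all_exists teach; exists T; split; last first.
  by apply/bigmax_leqP => B /TP[_ T6 _]; exact: leq_trans T6 _.
split=> [B /TP[]//|B B' BF B'F neqB].
(* Of two distinct sets one is not contained in the other, and its own teaching set then supplies
   the distinguishing vertex. *)
have key C C' : C \in closed_nbhd_family e -> C' \in closed_nbhd_family e ->
    ~~ (C \subset C') -> exists2 w, w \in T C & distinguishes w C C'.
  move=> CF C'F CC'; have [TC _ /(_ _ C'F CC') /subsetPn[w wT wC']] := TP _ CF.
  by exists w => //; rewrite /distinguishes (subsetP TC) // (negPf wC').
have [BB'|/(key _ _ BF B'F)[w wT dw]] := boolP (B \subset B'); last first.
  by exists w; rewrite // in_setU wT.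
have /(key _ _ B'F BF)[w wT dw] : ~~ (B' \subset B).
  by apply: contra neqB => B'B; rewrite eqEsubset BB'.
by exists w; rewrite ?in_setU ?wT ?orbT // /distinguishes eq_sym.
Qed.
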